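(* For all positive integers $n_X,n_Y,n_B,n_A$, one has $$\mathrm Q(n_X;n_Y,n_B)_{n_A}\subseteq\mathrm{NS}^{\mathrm{NA}}(n_X;n_Y,n_B)_{n_A}.$$
   Context: For a positive integer $n$, $[n]:=\{0,1,\dots,n-1\}$. Behavior: a behavior of the prepare-and-measure (PM) scenario $(n_X;n_Y,n_B)$ is a family $\mathbf q=[q(b|xy)]$ of real numbers, $b\in[n_B]$, $x\in[n_X]$, $y\in[n_Y]$, with $q(b|xy)\ge 0$ and $\sum_b q(b|xy)=1$ for all $x,y$. Quantum set: $\mathrm Q(n_X;n_Y,n_B)_{n_A}$ is the set of behaviors of the form $q(b|xy)=\operatorname{Tr}(M_{b|y}\rho_x)$, where $\rho_x$, $x\in[n_X]$, are density operators on $\mathbb C^{n_A}$ and, for each $y\in[n_Y]$, $\{M_{b|y}\}_{b\in[n_B]}$ is a POVM on $\mathbb C^{n_A}$ (positive semidefinite operators summing to the identity). Non-signaling (NS) box: for finite input and output sets, a bipartite NS box is a family of conditional probability distributions $p(\alpha\beta|\xi\eta)$ (Alice: input $\xi$, output $\alpha$; Bob: input $\eta$, output $\beta$) such that $\sum_\beta p(\alpha\beta|\xi\eta)$ does not depend on $\eta$ and $\sum_\alpha p(\alpha\beta|\xi\eta)$ does not depend on $\xi$. Non-adaptive NS-assisted set: $\mathrm{NS}^{\mathrm{NA}}(n_X;n_Y,n_B)_{n_A}$ is the set of behaviors of $(n_X;n_Y,n_B)$ of the form $q(b|xy)=\sum_{a=0}^{n_A-1}\sum_\beta p(a\beta|xy)\,p(b|a\beta)$,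 where $p(a\beta|xy)$ is a bipartite NS box (Alice: input $x\in[n_X]$, output $a\in[n_A]$; Bob: input $y\in[n_Y]$, output $\beta$ in some finite set of arbitrary size) and $p(\cdot|a\beta)$ is a conditional probability distribution on $[n_B]$. *)

(* Defs.v *)
(* MathComp, with the reals of MathComp-Analysis and the complex numbers R[i] of
   mathcomp-real-closed. *)
From HB Require Import structures.
From mathcomp Require Import all_boot all_order all_algebra.
From mathcomp Require Import complex.
From mathcomp Require Import classical_sets reals.

Set Implicit Arguments.
Unset Strict Implicit.
Unset Printing Implicit Defensive.

Import Order.TTheory GRing.Theory Num.Theory.

Local Open Scope ring_scope.
Local Open Scope complex_scope.
Local Open Scope sesquilinear_scope.
Local Open Scope classical_set_scope.

Definition is_distribution (R : realType) (T : finType) (f : T -> R) : Prop :=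
  (forall t, 0 <= f t) /\ \sum_(t : T) f t = 1.

(* The arguments of q are in the order of the notation q(b|xy). *)
Definition is_behavior (R : realType) (nX nY nB : nat)
    (q : 'I_nB -> 'I_nX -> 'I_nY -> R) : Prop :=
  forall x y, is_distribution (fun b => q b x y).

(* In the order of R[i], 0 <= z means that z is real and nonnegative. *)
Definition psdmx (R : realType) (n : nat) (A : 'M[R[i]]_n) : Prop :=
  A \is hermsymmx /\
  forall v : 'cV[R[i]]_n, 0 <= (v ^t* *m A *m v) ord0 ord0.

Definition is_density (R : realType) (n : nat) (rho : 'M[R[i]]_n) : Prop :=
  psdmx rho /\ \tr rho = 1.

Definition is_povm (R : realType) (n : nat) (T : finType)
    (M : T -> 'M[R[i]]_n) : Prop :=
  (forall b, psdmx (M b)) /\ \sum_(b : T) M b = 1%:M.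

Definition quantum_set (R : realType) (nX nY nB nA : nat) :
    set ('I_nB -> 'I_nX -> 'I_nY -> R) :=
  [set q | is_behavior q /\
    exists (rho : 'I_nX -> 'M[R[i]]_nA) (M : 'I_nY -> 'I_nB -> 'M[R[i]]_nA),
      [/\ forall x, is_density (rho x),
          forall y, is_povm (M y) &
          forall b x y, (q b x y)%:C = \tr (M y b *m rho x)]].

(* The arguments of p are in the order of the notation p(alpha beta|xi eta). *)
Definition is_ns_box (R : realType) (OA OB IA IB : finType)
    (p : OA -> OB -> IA -> IB -> R) : Prop :=
  [/\ forall xi eta, is_distribution (fun o : OA * OB => p o.1 o.2 xi eta),
      forall alpha xi eta eta',
        \sum_(beta : OB) p alpha beta xi eta =
        \sum_(beta : OB) p alpha beta xi eta' &
      forall beta eta xi xi',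
        \sum_(alpha : OA) p alpha beta xi eta =
        \sum_(alpha : OA) p alpha beta xi' eta].

(* T is the output set of Bob's side of the box. *)
Definition ns_na_set (R : realType) (nX nY nB nA : nat) :
    set ('I_nB -> 'I_nX -> 'I_nY -> R) :=
  [set q | is_behavior q /\
    exists (T : finType) (p : 'I_nA -> T -> 'I_nX -> 'I_nY -> R)
           (r : 'I_nB -> 'I_nA -> T -> R),
      [/\ is_ns_box p,
          forall a beta, is_distribution (fun b => r b a beta) &
          forall b x y,
            q b x y = \sum_(a < nA) \sum_(beta : T)
                        p a beta x y * r b a beta]].

Arguments quantum_set : clear implicits.
Arguments ns_na_set : clear implicits.

(* Main.v *)
(* For a single measurement [M], a quantum system of dimension [n] is simulated by
   one classical [n]-level message and shared randomness (Frenkel and Weiner).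
   Write each effect as a sum of rank-one terms [c^* c] indexed by pairs (outcome,
   [k]), and let the shared randomness be an [n]-tuple [g] of such pairs, of weight
   [|det (c_(g 1), ..., c_(g n))|^2 / n!].  By Cauchy-Binet the probability that all
   the outcomes in [g] lie in [S] is [det M_S].  Alice sends a position in [g] and
   Bob outputs the outcome found there; by the supply-demand theorem she can
   reproduce the statistics of [rho] as soon as
   [det M_S <= Tr (M_S rho)] for every [S], which holds since a product of
   eigenvalues in [0, 1] is at most any average of them.
   These simulations depend on [y].  They form a non-signaling box once the position
   is masked by a cyclic shift known to Bob, which makes Alice's message uniform. *)
Require Import Defs.
From mathcomp Require Import boolp classical_sets reals.
From mathcomp Require Import all_boot all_order all_algebra.
From mathcomp Require Import perm.
From mathcomp Require Import complex spectral sesquilinear.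

Set Implicit Arguments.
Unset Strict Implicit.
Unset Printing Implicit Defensive.

Import Order.TTheory GRing.Theory Num.Theory.

Local Open Scope ring_scope.
Local Open Scope complex_scope.
Local Open Scope sesquilinear_scope.

(** * Supply and demand on a finite bipartite graph *)

Section Transport.

Variables (R : realFieldType) (I J : finType) (N : I -> J -> bool).

Definition transportable (d : I -> R) (q : J -> R) : Prop :=
  exists w : I -> J -> R,
    [/\ forall i j, 0 <= w i j,
        forall i j, ~~ N i j -> w i j = 0,
        forall i, \sum_j w i j = d i &
        forall j, \sum_i w i j = q j].

(** The neighbourhood of [S] in the bipartite graph [N]. *)
Definition hits (S : {set J}) : pred I := fun i => [exists j in S, N i j].

Definition hall_condition (d : I -> R) (q : J -> R) : Prop :=
  forall S : {set J}, \sum_(j in S) q j <= \sum_(i | hits S i) d i.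

Lemma hits_sub (S T : {set J}) i : S \subset T -> hits S i -> hits T i.
Proof.
move=> /subsetP sST /existsP [j /andP[jS Nij]]; apply/existsP; exists j.
by rewrite sST.
Qed.

Lemma hitsU (S T : {set J}) i : hits (S :|: T) i = hits S i || hits T i.
Proof.
apply/idP/orP => [/existsP[j /andP[]]|].
  rewrite inE => /orP[jS|jT] Nij; [left|right]; apply/existsP; exists j;
  by rewrite ?jS ?jT.
by case; apply: hits_sub; [apply: subsetUl | apply: subsetUr].
Qed.

Lemma transportable_add (d d1 d2 : I -> R) (q q1 q2 : J -> R) :
  (forall i, d i = d1 i + d2 i) -> (forall j, q j = q1 j + q2 j) ->
  transportable d1 q1 -> transportable d2 q2 -> transportable d q.
Proof.
move=> dE qE [w1 [w1_ge0 w1N w1d w1q]] [w2 [w2_ge0 w2N w2d w2q]].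
exists (fun i j => w1 i j + w2 i j); split => [i j|i j Nij|i|j].
- by rewrite addr_ge0.
- by rewrite w1N ?w2N ?addr0.
- by rewrite big_split /= w1d w2d.
- by rewrite big_split /= w1q w2q.
Qed.

Lemma transportable_edge i0 j0 (e : R) : 0 <= e -> N i0 j0 ->
  transportable (fun i => if i == i0 then e else 0)
                (fun j => if j == j0 then e else 0).
Proof.
move=> e_ge0 N0; exists (fun i j => if (i == i0) && (j == j0) then e else 0).
split=> [i j|i j Nij|i|j].
- by case: ifP.
- by case: ifP => // /andP[/eqP ii /eqP jj]; rewrite ii jj N0 in Nij.
- by case: eqP => _ /=; rewrite -?big_mkcond ?big_pred1_eq ?big1.
- rewrite -big_mkcond; case: eqP => _ /=.
    by under eq_bigl do rewrite andbT; rewrite big_pred1_eq.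
  by rewrite big_pred0 // => i; rewrite andbF.
Qed.

(** Induction on the number of nonzero supplies and demands. As much as possible is sent along an
    edge with nonzero ends, until an end is exhausted or a Hall inequality becomes tight; in the
    latter case the problem splits into two smaller ones. *)
Theorem supply_demand (d : I -> R) (q : J -> R) :
  (forall i, 0 <= d i) -> (forall j, 0 <= q j) -> \sum_i d i = \sum_j q j ->
  hall_condition d q -> transportable d q.
Proof.
have [n] := ubnP (#|[pred i | d i != 0]| + #|[pred j | q j != 0]|).
elim: n d q => // n IHn d q.
(* A tight set [S] decouples the edges meeting [S] from the others. *)
have split_tight : forall (d : I -> R) (q : J -> R) (S : {set J}) i0 j0,
    (#|[pred i | d i != 0%R]| + #|[pred j | q j != 0%R]| < n.+1)%N ->
    (forall i, 0 <= d i) -> (forall j, 0 <= q j) ->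
    \sum_i d i = \sum_j q j -> hall_condition d q -> d i0 != 0 -> hits S i0 ->
    q j0 != 0 -> j0 \notin S ->
    \sum_(j in S) q j = \sum_(i | hits S i) d i -> transportable d q.
  move=> {}d {}q S i0 j0 size_lt d_ge0 q_ge0 sum_eq hall di0 Si0 qj0 Sj0 tight.
  (* The part inside [S] loses the demand [q j0] and the part outside loses the supply [d i0], so
     the induction hypothesis applies to both. *)
  pose d1 i := if hits S i then d i else 0; pose d2 i := if hits S i then 0 else d i.
  pose q1 j := if j \in S then q j else 0; pose q2 j := if j \in S then 0 else q j.
  have d1_ge0 i : 0 <= d1 i by rewrite /d1; case: ifP.
  have d2_ge0 i : 0 <= d2 i by rewrite /d2; case: ifP.
  have q1_ge0 j : 0 <= q1 j by rewrite /q1; case: ifP.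
  have q2_ge0 j : 0 <= q2 j by rewrite /q2; case: ifP.
  have dE i : d i = d1 i + d2 i by rewrite /d1 /d2; case: ifP; rewrite ?addr0 ?add0r.
  have qE j : q j = q1 j + q2 j by rewrite /q1 /q2; case: ifP; rewrite ?addr0 ?add0r.
  have sum1 : \sum_i d1 i = \sum_j q1 j by rewrite -!big_mkcond /= tight.
  have sum2 : \sum_i d2 i = \sum_j q2 j.
    apply: (addrI (\sum_i d1 i)); rewrite {2}sum1 -!big_split /=.
    by rewrite -(eq_bigr _ (fun i _ => dE i)) -(eq_bigr _ (fun j _ => qE j)).
  apply: (transportable_add dE qE); apply: IHn => //.
  - rewrite -ltnS (leq_trans _ size_lt) // ltnS -addnS leq_add //.
      by apply/subset_leq_card/subsetP => i; rewrite !inE /d1; case: ifP; rewrite ?eqxx.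
    apply/proper_card/properP; split.
      by apply/subsetP => j; rewrite !inE /q1; case: ifP; rewrite ?eqxx.
    by exists j0; rewrite !inE /q1 ?qj0 ?(negbTE Sj0) ?eqxx.
  (* Hall's condition inside: every neighbour of [T :&: S] is a neighbour of both [T] and [S]. *)
  - move=> T; rewrite /q1 /d1 -!big_mkcondr.
    rewrite (eq_bigl (mem (T :&: S))) => [|j]; last by rewrite !inE.
    apply: le_trans (hall _) _.
    rewrite [leRHS](bigID (hits (T :&: S))) /= -[leLHS]addr0 lerD ?sumr_ge0 //.
    rewrite le_eqVlt; apply/orP; left; apply/eqP/eq_bigl => i.
    apply/idP/andP => [h|[] //]; split=> //; apply/andP; split;
      by apply: hits_sub h; rewrite ?subsetIl ?subsetIr.
  - rewrite -ltnS (leq_trans _ size_lt) // ltnS -addSn leq_add //.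
      apply/proper_card/properP; split.
        by apply/subsetP => i; rewrite !inE /d2; case: ifP; rewrite ?eqxx.
      by exists i0; rewrite !inE /d2 ?di0 ?Si0 ?eqxx.
    by apply/subset_leq_card/subsetP => j; rewrite !inE /q2; case: ifP; rewrite ?eqxx.
  (* Hall's condition outside: adding the tight equality for [S] turns it into the condition for
     [S :|: T]. *)
  - move=> T; rewrite -(lerD2l (\sum_(j in S) q j)) {2}tight.
    have -> : \sum_(j in S) q j + \sum_(j in T) q2 j = \sum_(j in S :|: T) q j.
      rewrite [RHS](bigID (mem S)) /=; congr (_ + _).
        by apply: eq_bigl => j; rewrite !inE; case: (j \in S); rewrite ?andbF.
      rewrite [LHS](bigID (mem S)) /= big1 ?add0r => [|j /andP[_ jS]]; last by rewrite /q2 jS.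
      apply: eq_big => [j|j /andP[_ /negbTE jS]]; last by rewrite /q2 jS.
      by rewrite !inE; case: (j \in S); rewrite ?andbF ?andbT.
    have -> : \sum_(i | hits S i) d i + \sum_(i | hits T i) d2 i
              = \sum_(i | hits (S :|: T) i) d i.
      rewrite [RHS](bigID (hits S)) /=; congr (_ + _).
        by apply: eq_bigl => i; rewrite hitsU; case: (hits S i); rewrite ?andbF.
      rewrite [LHS](bigID (hits S)) /= big1 ?add0r => [|i /andP[_ iS]]; last by rewrite /d2 iS.
      apply: eq_big => [i|i /andP[_ /negbTE iS]]; last by rewrite /d2 iS.
      by rewrite hitsU; case: (hits S i); rewrite ?andbF ?andbT.
    exact: hall.
move=> size_lt d_ge0 q_ge0 sum_eq hall.
have [q0|] := boolP [forall j, q j == 0].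
  have q_0 j : q j = 0 by apply/eqP/(forallP q0).
  have d_0 i : d i = 0.
    apply/eqP; move: sum_eq; rewrite [RHS]big1 // => /eqP.
    by rewrite psumr_eq0 // => /allP; apply; rewrite mem_index_enum.
  exists (fun _ _ => 0); split=> // [i|j]; by rewrite big1.
rewrite negb_forall => /existsP[j0 qj0].
have qj0_gt0 : 0 < q j0 by rewrite lt_def qj0 q_ge0.
(* Hall's condition for [[set j0]] provides a neighbour with nonzero supply. *)
have [i0 /andP[Ni0 di0]] : exists i, N i j0 && (d i != 0).
  apply/existsP; apply: contraLR qj0_gt0; rewrite negb_exists => /forallP nex.
  rewrite -leNgt; have := hall [set j0]; rewrite big_set1 => /le_trans; apply.
  rewrite big1 // => i /existsP[j /andP[/set1P -> Nij]].
  by have := nex i; rewrite Nij negbK => /eqP.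
have di0_gt0 : 0 < d i0 by rewrite lt_def di0 d_ge0.
pose slack (S : {set J}) := \sum_(i | hits S i) d i - \sum_(j in S) q j.
have slack_ge0 S : 0 <= slack S by rewrite subr_ge0 hall.
pose free (S : {set J}) := (j0 \notin S) && hits S i0.
(* Sending [e] along the edge [(i0, j0)] only shrinks the slack of the sets
   satisfying [free]. *)
pose d' e i := d i - (if i == i0 then e else 0).
pose q' e j := q j - (if j == j0 then e else 0).
have sumI (e : R) S : \sum_(i | hits S i && (i == i0)) e = if hits S i0 then e else 0.
  case: ifP => S0; last first.
    by rewrite big_pred0 // => i; case: eqP => [->|]; rewrite ?S0 ?andbF.
  rewrite (eq_bigl (pred1 i0)) ?big_pred1_eq // => i /=.
  by case: eqP => [->|]; rewrite ?S0 ?andbF.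
have sumJ (e : R) (S : {set J}) : \sum_(j in S | j == j0) e = if j0 \in S then e else 0.
  case: ifP => S0; last first.
    by rewrite big_pred0 // => j; case: eqP => [->|]; rewrite ?S0 ?andbF.
  rewrite (eq_bigl (pred1 j0)) ?big_pred1_eq // => j /=.
  by case: eqP => [->|]; rewrite ?S0 ?andbF.
have push e : 0 <= e -> e <= d i0 -> e <= q j0 ->
    (forall S, free S -> e <= slack S) ->
    [/\ forall i, 0 <= d' e i, forall j, 0 <= q' e j,
        \sum_i d' e i = \sum_j q' e j & hall_condition (d' e) (q' e)].
  move=> e_ge0 ed eq eS; split => [i|j||S].
  - by rewrite /d'; case: eqP => [->|_]; rewrite ?subr_ge0 ?subr0.
  - by rewrite /q'; case: eqP => [->|_]; rewrite ?subr_ge0 ?subr0.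
  - by rewrite !sumrB sum_eq -!big_mkcond !big_pred1_eq.
  - rewrite !sumrB -!big_mkcondr /=.
    rewrite sumI sumJ; have [jS|jS] := boolP (j0 \in S).
      have -> : hits S i0 by apply/existsP; exists j0; rewrite jS.
      by rewrite lerD2r.
    have [iS|iS] := boolP (hits S i0); last by rewrite !subr0.
    by have := eS S; rewrite /free jS iS /slack subr0 !lerBrDr addrC; apply.
have reduce e : 0 <= e -> transportable (d' e) (q' e) -> transportable d q.
  move=> e_ge0 te; apply: transportable_add te (transportable_edge e_ge0 Ni0).
  - by move=> i; rewrite /d' subrK.
  - by move=> j; rewrite /q' subrK.
have card_d e : (#|[pred i | d' e i != 0%R]| <= #|[pred i | d i != 0%R]|)%N.
  apply/subset_leq_card/subsetP => i; rewrite !inE /d'.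
  by case: (eqVneq i i0) => [-> //|_]; rewrite subr0.
have card_q e : (#|[pred j | q' e j != 0%R]| <= #|[pred j | q j != 0%R]|)%N.
  apply/subset_leq_card/subsetP => j; rewrite !inE /q'.
  by case: (eqVneq j j0) => [-> //|_]; rewrite subr0.
pose e := Num.min (d i0) (q j0).
have e_ge0 : 0 <= e by rewrite le_min !ltW.
have [ed eq] : e <= d i0 /\ e <= q j0 by rewrite !ge_min !lexx orbT.
(* If no free set has slack below [e], sending [e] exhausts [i0] or [j0]. *)
have [/forallP all_slack|] := boolP [forall S, free S ==> (e <= slack S)].
  have [? ? ? ?] := push e e_ge0 ed eq (fun S fS => implyP (all_slack S) fS).
  apply: (reduce e) => //; apply: IHn => //.
  rewrite -ltnS (leq_trans _ size_lt) // ltnS.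
  have [dq|qd] := leP (d i0) (q j0).
    rewrite -addSn leq_add //; apply/proper_card/properP; split.
      apply/subsetP => i; rewrite !inE /d'.
      by case: (eqVneq i i0) => [-> //|_]; rewrite subr0.
    by exists i0; rewrite !inE // /d' eqxx /e (min_idPl dq) subrr eqxx.
  rewrite -addnS leq_add //; apply/proper_card/properP; split.
    apply/subsetP => j; rewrite !inE /q'.
    by case: (eqVneq j j0) => [-> //|_]; rewrite subr0.
  by exists j0; rewrite !inE // /q' eqxx /e (min_idPr (ltW qd)) subrr eqxx.
rewrite negb_forall => /existsP[S0]; rewrite negb_imply -ltNge => /andP[fS0 S0e].
(* Otherwise the least slack of a free set is sent: the minimizer [S] becomes tight, while [i0] and
   [j0] keep nonzero weights because the amount is below [e]. *)
case: (arg_minP slack fS0) => S fS Smin.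
have Se : slack S < e by apply: le_lt_trans S0e; apply: Smin.
have Sd := lt_le_trans Se ed; have Sq := lt_le_trans Se eq.
have [j0S iS] := andP fS.
have [d1 q1 s1 h1] := push _ (slack_ge0 S) (ltW Sd) (ltW Sq) Smin.
apply: (reduce (slack S)) => //; apply: (split_tight _ _ S i0 j0) => //.
- exact: leq_ltn_trans (leq_add (card_d _) (card_q _)) size_lt.
- by rewrite /d' eqxx subr_eq0 gt_eqF.
- by rewrite /q' eqxx subr_eq0 gt_eqF.
- rewrite !sumrB -!big_mkcondr /= sumI sumJ iS (negbTE j0S) subr0.
  by rewrite /slack opprB addrCA subrr addr0.
Qed.
End Transport.

(** * A Cauchy-Binet formula over tuples *)

(** Tuples replace the usual [n]-subsets: a tuple with a repetition contributes 0 and each subset is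
    counted n! times. *)
Lemma cauchy_binet_ffun (F : comNzRingType) (T : finType) (n : nat)
    (P : pred T) (X Y : T -> 'rV[F]_n) :
  \sum_(g : {ffun 'I_n -> T} | g \in ffun_on P)
    \det (\matrix_i X (g i)) * \det (\matrix_i Y (g i)) =
  n`!%:R * \det (\sum_(t | P t) (Y t)^T *m X t).
Proof.
under eq_bigr => g _ do rewrite [X in _ * X]/determinant big_distrr /=.
rewrite exchange_big /= -card_Sn -sum1_card natr_sum big_distrl /=.
apply: eq_bigr => s _; rewrite mul1r.
(* Permuting the tuple by [s] produces the sign of [s] a second time, so all permutations in the
   expansion of the second determinant contribute equally. *)
pose sh (h : {ffun 'I_n -> T}) := [ffun i => h (s i)].
have sh_bij : bijective sh.
  exists (fun h : {ffun 'I_n -> T} => [ffun i => h (perm.perm_inv s i)]) => h;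
    by apply/ffunP => i; rewrite !ffunE ?perm.permKV ?perm.permK.
rewrite (reindex sh) /=; last exact: onW_bij.
transitivity (\sum_(h : {ffun 'I_n -> T} | h \in ffun_on P)
    \det (\matrix_(i, k) (Y (h i) 0 i * X (h i) 0 k))).
  apply: eq_big => [h|h _].
    apply/ffun_onP/ffun_onP => hP i; last by rewrite ffunE.
    by have := hP (perm.perm_inv s i); rewrite ffunE perm.permKV.
  have -> : (\matrix_i X (sh h i)) = row_perm s (\matrix_i X (h i)).
    by apply/matrixP => i k; rewrite !mxE ffunE.
  rewrite row_permE det_mulmx det_perm mulrACA.
  rewrite -signr_addb addbb mul1r.
  rewrite (reindex_inj (@perm.perm_inj _ (perm.perm_inv s))) /=.
  transitivity ((\prod_i Y (h i) 0 i) * \det (\matrix_i X (h i))).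
    rewrite mulrC; congr (_ * _); apply: eq_bigr => i _.
    by rewrite !mxE !ffunE perm.permKV.
  rewrite /determinant big_distrr /=; apply: eq_bigr => t _.
  rewrite mulrCA -big_split /=; congr (_ * _).
  by apply: eq_bigr => i _; rewrite !mxE.
(* Multilinearity in the rows: choosing one summand per row amounts to choosing a tuple [h]. *)
rewrite /determinant exchange_big /=; apply: eq_bigr => t _.
rewrite -big_distrr /=; congr (_ * _).
under [RHS]eq_bigr => i _ do rewrite summxE.
rewrite bigA_distr_big /=; apply: eq_bigr => h _.
by apply: eq_bigr => i _; rewrite !mxE big_ord1 !mxE.
Qed.

(** * Positive semidefinite matrices *)

Section Psd.

Variables (R : realType) (n : nat).
Local Notation C := R[i].

Lemma psdmx_conj_diag (A P : 'M[C]_n) k : psdmx A -> 0 <= (P *m A *m P^t*) k k.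
Proof.
move=> [_ /(_ ((row k P)^t*))]; rewrite trmxCK -row_mul.
by congr (0 <= _); rewrite !mxE; apply: eq_bigr => i _; rewrite !mxE.
Qed.

Lemma psdmx_spectral (A : 'M[C]_n) : psdmx A ->
  exists (P : 'M[C]_n) (x : 'rV[C]_n),
    [/\ P \is unitarymx, forall k, 0 <= x 0 k & A = P^t* *m diag_mx x *m P].
Proof.
move=> Apsd; have [Aherm _] := Apsd.
pose P := spectralmx A; pose x := spectral_diag A.
have Punit : P \is unitarymx := spectral_unitarymx A.
have AE : A = P^t* *m diag_mx x *m P.
  by rewrite -invmx_unitary //; apply/orthomx_spectralP/hermitian_normalmx/Aherm.
exists P, x; split=> // k; have := psdmx_conj_diag P k Apsd.
rewrite {1}AE !mulmxA (unitarymxP Punit) mul1mx -mulmxA (unitarymxP Punit) mulmx1.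
by rewrite mxE eqxx mulr1n.
Qed.

(** The rows of a diagonalizing unitary are rescaled by the square roots of the eigenvalues. *)
Lemma psdmx_sum_rank1 (A : 'M[C]_n) : psdmx A ->
  exists c : 'I_n -> 'rV[C]_n, A = \sum_k (c k)^t* *m c k.
Proof.
move=> /psdmx_spectral [P [x [_ x_ge0 ->]]].
exists (fun k => sqrtC (x 0 k) *: row k P); apply/matrixP => i j.
rewrite summxE mul_mx_diag mxE; apply: eq_bigr => k _.
rewrite !mxE big_ord1 !mxE rmorphM /= (@conj_Creal _ (sqrtC _)); last first.
  by rewrite ger0_real ?sqrtC_ge0.
by rewrite mulrACA -expr2 sqrtCK mulrA; congr (_ * _); rewrite mulrC.
Qed.

(** In an eigenbasis of [B] the diagonal of [rho] is a probability vector, and the trace is the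
    average of the eigenvalues of [B] for it. These lie in [0, 1], so their product is at most each
    of them. *)
Lemma det_le_trace_density (B rho : 'M[C]_n) :
  psdmx B -> psdmx (1%:M - B) -> is_density rho -> \det B <= \tr (B *m rho).
Proof.
move=> /psdmx_spectral [P [x [Punit x_ge0 BE]]] B_le1 [rho_psd rho_tr].
have PP : P *m P^t* = 1%:M by apply/unitarymxP.
have PP' : P^t* *m P = 1%:M by apply: mulmx1C.
have x_le1 k : x 0 k <= 1.
  have := psdmx_conj_diag P k B_le1.
  rewrite mulmxBr mulmxBl mulmx1 PP BE !mulmxA PP mul1mx -mulmxA PP mulmx1.
  by rewrite !mxE eqxx mulr1n subr_ge0.
pose r := P *m rho *m P^t*.
have r_ge0 k : 0 <= r k k by apply: psdmx_conj_diag.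
have r_sum : \sum_k r k k = 1.
  by rewrite -/(\tr r) /r mxtrace_mulC mulmxA PP' mul1mx.
have -> : \tr (B *m rho) = \sum_k x 0 k * r k k.
  rewrite BE -!mulmxA mxtrace_mulC -mulmxA.
  by apply: eq_bigr => k _; rewrite mul_diag_mx mxE.
have -> : \det B = \prod_k x 0 k.
  by rewrite BE !det_mulmx mulrAC -det_mulmx PP' det1 mul1r det_diag.
rewrite -[leLHS]mulr1 -[X in _ * X <= _]r_sum big_distrr /=; apply: ler_sum => k _.
rewrite ler_wpM2r // (bigD1 k) //= -[leRHS]mulr1 ler_wpM2l //.
by apply: prodr_ile1 => i _; rewrite x_ge0 x_le1.
Qed.
End Psd.

Lemma psdmx_sum (R : realType) (n : nat) (T : finType) (P : pred T)
    (A : T -> 'M[R[i]]_n) : (forall t, psdmx (A t)) -> psdmx (\sum_(t | P t) A t).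
Proof.
move=> A_psd; elim/big_ind: _ => [|B C [Bh Bp] [Ch Cp]|t _]; last exact: A_psd.
  split=> [|v]; first by rewrite is_hermitianmxE trmx0 map_mx0 scaler0.
  by rewrite mulmx0 mul0mx mxE.
split=> [|v]; last by rewrite mulmxDr mulmxDl mxE addr_ge0.
move: Bh Ch; rewrite !is_hermitianmxE !expr0 !scale1r => /eqP BE /eqP CE.
by rewrite linearD map_mxD -BE -CE.
Qed.

(** * Classical simulation of a single measurement *)

Section Simulation.

Variables (R : realType) (n : nat) (T : finType).
Local Notation G := {ffun 'I_n -> T * 'I_n}.

Lemma povm_index_weights (M : T -> 'M[R[i]]_n) : is_povm M ->
  exists D : G -> R, (forall g, 0 <= D g) /\
    forall S : {set T},
      (\sum_(g : G | [forall i, (g i).1 \in S]) D g)%:C = \det (\sum_(b in S) M b).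
Proof.
move=> [M_psd _].
have [c cE] := choice (fun b => psdmx_sum_rank1 (M_psd b)).
pose X (t : T * 'I_n) := c t.1 t.2.
(* [Z g] is real but has a complex type, hence the real part in the witness. *)
pose Z (g : G) : R[i] := `|\det (\matrix_i X (g i))| ^+ 2.
have ZE g : (complex.Re (Z g))%:C = Z g by rewrite RRe_real // ger0_real // exprn_ge0.
have n_neq0 : (n`!%:R : R[i]) != 0 by rewrite pnatr_eq0 -lt0n fact_gt0.
exists (fun g => complex.Re (Z g) / n`!%:R); split=> [g|S].
  by rewrite divr_ge0 ?ler0n // -ler0c ZE exprn_ge0.
rewrite -big_distrl rmorphM fmorphV rmorph_nat rmorph_sum.
apply: (canLR (mulfK n_neq0)); rewrite [RHS]mulrC.
pose P (t : T * 'I_n) := t.1 \in S.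
have -> : \sum_(b in S) M b = \sum_(t | P t) (map_mx Num.conj (X t))^T *m X t.
  rewrite (eq_bigr _ (fun b _ => cE b)) pair_big_dep /=.
  by apply: eq_big => [t|t _]; rewrite ?andbT // map_trmx.
(* With the second family conjugate to the first, each Cauchy-Binet term is a squared modulus. *)
rewrite -cauchy_binet_ffun; apply: eq_big => [g|g _].
  by apply/forallP/ffun_onP.
apply: (etrans (ZE g)); rewrite /Z normCK; congr (_ * _).
rewrite -det_map_mx; congr (\det _).
by apply/matrixP => i j; rewrite !mxE.
Qed.

(** [D] is fixed before the state, so Bob's share of the randomness cannot reveal it. [s a g] is the
    joint probability of the tuple [g] and the message [a], a position in [g]. *)
Theorem povm_classical_simulation (M : T -> 'M[R[i]]_n) : is_povm M ->
  exists D : G -> R, is_distribution D /\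
    forall (rho : 'M[R[i]]_n) (q : T -> R), is_density rho -> is_distribution q ->
      (forall b, (q b)%:C = \tr (M b *m rho)) ->
      exists s : 'I_n -> G -> R,
        [/\ forall a g, 0 <= s a g,
            forall g, \sum_a s a g = D g &
            forall b, q b = \sum_g \sum_a s a g * (b == (g a).1)%:R].
Proof.
move=> M_povm; have [M_psd M_sum] := M_povm.
have [D [D_ge0 DE]] := povm_index_weights M_povm.
have D_sum : \sum_g D g = 1.
  apply: (@complexI R); rewrite [RHS]rmorph1 -(@det1 _ n) -M_sum.
  have := DE setT; rewrite (eq_bigl predT) => [->|g].
    by congr (\det _); apply: eq_bigl => b; rewrite inE.
  by apply/forallP => i; rewrite inE.
exists D; split=> // rho q rho_density [q_ge0 q_sum] qE.
pose N (g : G) b := [exists i, (g i).1 == b].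
have sum_setC (S : {set T}) (V : nmodType) (F : T -> V) :
    \sum_b F b = \sum_(b in S) F b + \sum_(b in ~: S) F b.
  by rewrite (bigID (mem S)) /=; congr (_ + _); apply: eq_bigl => b; rewrite inE.
(* Passing to complements: the tuples not hit by [S] are those with all outcomes in [~: S], and
   their weight is a determinant bounded by the trace that gives the probability of [~: S]. *)
have hall : hall_condition N D q.
  move=> S; rewrite -(lerD2r (\sum_(b in ~: S) q b)).
  have -> : \sum_(b in S) q b + \sum_(b in ~: S) q b = \sum_g D g.
    by rewrite D_sum -q_sum (sum_setC S).
  rewrite (bigID (hits N S)) /= lerD2l.
  have -> : \sum_(g | ~~ hits N S g) D g
      = \sum_(g : G | [forall i, (g i).1 \in ~: S]) D g.
    apply: eq_bigl => g; apply/idP/forallP => [nh i|aS].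
      rewrite inE; apply: contra nh => giS; apply/existsP; exists (g i).1.
      by rewrite giS; apply/existsP; exists i.
    apply/existsP => -[b /andP[bS /existsP[i /eqP gb]]].
    by have := aS i; rewrite gb inE bS.
  rewrite -lecR DE rmorph_sum (eq_bigr _ (fun b _ => qE b)).
  rewrite -linear_sum -mulmx_suml; apply: det_le_trace_density => //.
    exact: psdmx_sum.
  have -> : 1%:M - \sum_(b in ~: S) M b = \sum_(b in S) M b.
    by rewrite -M_sum (sum_setC S) addrK.
  exact: psdmx_sum.
have [w [w_ge0 wN wD wq]] := supply_demand D_ge0 q_ge0 (etrans D_sum (esym q_sum)) hall.
(* The mass [w g b] goes to one position of [g] carrying [b]; it vanishes if there is none. *)
pose pk (g : G) b := [pick i | (g i).1 == b].
exists (fun a g => \sum_b w g b * (pk g b == Some a)%:R).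
have pkE (g : G) b (f : 'I_n -> R) (y : R) : (forall a, (g a).1 = b -> f a = y) ->
    \sum_a w g b * (pk g b == Some a)%:R * f a = w g b * y.
  move=> fy; rewrite /pk; case: pickP => [a0 /eqP ga0|none]; last first.
    have w0 : w g b = 0 by apply: wN; apply/existsP => -[a]; rewrite none.
    by rewrite w0 mul0r big1 // => a _; rewrite !mul0r.
  rewrite (bigD1 a0) //= eqxx mulr1 fy // big1 ?addr0 // => a a0a.
  by rewrite (inj_eq (@Some_inj _)) eq_sym (negbTE a0a) mulr0 mul0r.
split=> [a g|g|b].
- by apply: sumr_ge0 => b _; rewrite mulr_ge0.
- rewrite exchange_big /= -wD; apply: eq_bigr => b _.
  rewrite -[RHS]mulr1 -(pkE g b (fun=> 1) 1) //.
  by apply: eq_bigr => a _; rewrite mulr1.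
- rewrite -wq; apply: eq_bigr => g _.
  transitivity (\sum_b' w g b' * (b == b')%:R).
    rewrite (bigD1 b) //= eqxx mulr1 big1 ?addr0 // => b' nb.
    by rewrite eq_sym (negbTE nb) mulr0.
  under [RHS]eq_bigr => a _ do rewrite big_distrl /=.
  rewrite exchange_big /=; apply: eq_bigr => b' _.
  by rewrite -(pkE g b' (fun a => (b == (g a).1)%:R)) // => a ->.
Qed.

End Simulation.

(** * Masking the message to obtain a non-signaling box *)

Theorem theorem2 (R : realType) (nX nY nB nA : nat)
    (hX : (0 < nX)%N) (hY : (0 < nY)%N) (hB : (0 < nB)%N) (hA : (0 < nA)%N) :
  (quantum_set R nX nY nB nA `<=` ns_na_set R nX nY nB nA)%classic.
Proof.
(* The successor form gives ['I_n.+1] its cyclic addition. *)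
case: nA hA => // n _ q [q_behavior [rho [M [rhoD M_povm qE]]]]; split=> //.
pose G := {ffun 'I_n.+1 -> 'I_nB * 'I_n.+1}.
have [D DP] := choice (fun y => povm_classical_simulation (M_povm y)).
have [s sP] := choice (fun xy : 'I_nX * 'I_nY =>
  (DP xy.2).2 (rho xy.1) (fun b => q b xy.1 xy.2) (rhoD xy.1)
    (q_behavior xy.1 xy.2) (fun b => qE b xy.1 xy.2)).
have s_ge0 x y a g : 0 <= s (x, y) a g by have [] := sP (x, y).
have sD x y g : \sum_a s (x, y) a g = D y g by have [] := sP (x, y).
have sq x y b : q b x y = \sum_g \sum_a s (x, y) a g * (b == (g a).1)%:R.
  by have [] := sP (x, y).
have n_neq0 : (n.+1%:R : R) != 0 by rewrite pnatr_eq0.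
(* Bob receives the tuple [beta.1] and a uniform shift [beta.2]; Alice's output is the position
   minus the shift, and [r] adds the shift back. *)
pose p a (beta : G * 'I_n.+1) x y := s (x, y) (a + beta.2) beta.1 / n.+1%:R.
pose r b a (beta : G * 'I_n.+1) : R := (b == (beta.1 (a + beta.2)).1)%:R.
(* Summing over the shift runs through all positions, so Alice's output is uniform whatever [x] and
   [y]. *)
have p_alice a x y : \sum_beta p a beta x y = n.+1%:R^-1.
  rewrite -(pair_bigA _ (fun g c => s (x, y) (a + c) g / n.+1%:R)) /=.
  rewrite -[RHS]mul1r -(DP y).1.2 big_distrl /=; apply: eq_bigr => g _.
  by rewrite -big_distrl -(sD x y) [in RHS](reindex_inj (addrI a)).
have p_bob (beta : G * 'I_n.+1) x y : \sum_a p a beta x y = D y beta.1 / n.+1%:R.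
  by rewrite -big_distrl -(sD x y) [in RHS](reindex_inj (addIr beta.2)).
exists (G * 'I_n.+1)%type, p, r; split.
- split=> [x y|a x y y'|beta y x x']; rewrite ?p_alice ?p_bob //.
  split=> [o|]; first by rewrite divr_ge0 ?ler0n.
  rewrite -(pair_bigA _ (fun a beta => p a beta x y)) /=.
  rewrite (eq_bigr _ (fun a _ => p_alice a x y)) sumr_const card_ord.
  by rewrite -[LHS]mulr_natl divff.
- move=> a beta; split=> [b|]; first by rewrite ler0n.
  rewrite (bigD1 (beta.1 (a + beta.2)).1) //= /r eqxx big1 ?addr0 // => b.
  by move=> /negbTE ->.
- move=> b x y; rewrite exchange_big /= sq.
  pose f g := \sum_a s (x, y) a g * (b == (g a).1)%:R.
  (* Once unmasked, every shift gives the same sum over positions; the [n.+1] shifts then cancel the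
     factor of the mask. *)
  have fE (beta : G * 'I_n.+1) : \sum_a p a beta x y * r b a beta = f beta.1 / n.+1%:R.
    rewrite /f [in RHS](reindex_inj (addIr beta.2)) [RHS]big_distrl /=.
    by apply: eq_bigr => a _; rewrite mulrAC.
  rewrite (eq_bigr _ (fun beta _ => fE beta)).
  rewrite -(pair_bigA _ (fun g (c : 'I_n.+1) => f g / n.+1%:R)) /=.
  apply: eq_bigr => g _; rewrite sumr_const card_ord -mulrnAl -[f g *+ _]mulr_natr.
  by rewrite mulfK.
Qed.
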